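(* There is no positive integer $n$ with $p^2(n,5)=188$; that is, no positive integer can be expressed as the sum of exactly $5$ positive squares in exactly $188$ ways.
   Context: $p^2(n,j)$ denotes the number of ways to write $n$ as a sum of exactly $j$ positive squares, up to order of summands (the number of partitions of $n$ into exactly $j$ parts that are positive squares). *)

(* Defs.v *)
From mathcomp Require Import all_boot.

Set Implicit Arguments.
Unset Strict Implicit.
Unset Printing Implicit Defensive.

(* The root of k is at most k, so searching 'I_k.+1 loses nothing. *)
Definition pos_square (k : nat) : bool :=
  (0 < k) && [exists m : 'I_k.+1, m ^ 2 == k].

Lemma pos_squareP (k : nat) :
  reflect (exists2 m, 0 < m & k = m ^ 2) (pos_square k).
Proof.
apply: (iffP andP) => [[k0 /existsP[m /eqP mk]]|[m m0 ->]].
  by exists (val m) => //; case: (posnP (val m)) k0 mk => // -> /[swap] <-.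
split; first by rewrite expn_gt0 m0.
have lem : m < (m ^ 2).+1 by rewrite ltnS expnS expn1 leq_pmulr.
by apply/existsP; exists (Ordinal lem).
Qed.

(* A partition of n into j parts is encoded as the nonincreasing j-tuple of
   its parts; every part of a partition of n is at most n, hence in 'I_n.+1. *)
Definition square_partitions (n j : nat) : {set j.-tuple 'I_n.+1} :=
  [set t : j.-tuple 'I_n.+1 | let s := [seq val i | i <- t] in
     [&& sorted geq s, all pos_square s & sumn s == n]].

Lemma square_partitionsP (n j : nat) (s : seq nat) :
  (exists2 t : j.-tuple 'I_n.+1, t \in square_partitions n j & map val t = s) <->
  [/\ size s = j, sorted geq s, all pos_square s & sumn s = n].
Proof.
split=> [[t]|[sz so al su]].
  rewrite inE => /and3P[a b /eqP c] <-; split => //; by rewrite size_map size_tuple.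
have le x : x \in s -> x < n.+1.
  rewrite ltnS -su; elim: s {sz so al su} => //= y s IH; rewrite inE => /orP[/eqP->|/IH h].
      exact: leq_addr.
  exact: leq_trans h (leq_addl _ _).
have E : map val (map (@inord n) s) = s.
  rewrite -map_comp -[RHS]map_id; apply/eq_in_map => x /le xn /=; exact: inordK.
have T : size (map (@inord n) s) == j by rewrite size_map sz.
exists (Tuple T) => //; rewrite inE /= E so al su eqxx //.
Qed.

Definition p2 (n j : nat) : nat := #|square_partitions n j|.

(* Main.v *)
From Corelib Require Import BinNums PosDef.
Require Import Defs.
From mathcomp Require Import all_boot.
From mathcomp Require Import all_order all_algebra.
From mathcomp Require Import zify ring.

Set Implicit Arguments.
Unset Strict Implicit.
Unset Printing Implicit Defensive.

Import GRing.Theory Num.Theory Order.TTheory.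

(** Let r_j(n) be the number of integer vectors of length j and squared norm n.
    A partition of n into 5 positive squares comes from at most 2^5 5! vectors,
    and the vectors with a zero coordinate number at most 5 r_4(n), so
    r_5(n) <= 5 r_4(n) + 3840 p^2(n,5). On the other hand r_5(n) is the sum of
    r_4(n - a^2), which by Jacobi's formula r_4(m) = 8 sigma(m), m odd, is of
    order n^(3/2), while r_4(n) is of smaller order. This forces
    p^2(n,5) > 188 for n >= 10000; smaller n are tabulated.

    Jacobi's formula comes from the count T(4u) of odd vectors of length 4 and
    norm 4u. Permuting the coordinates of 5-tuples gives, for N = 5 mod 8, the
    recurrence sum_(a odd) (N - 5 a^2) T(N - a^2) = 0, and 16 sigma(u) satisfies
    the same recurrence thanks to a sign-reversing involution on the solutions
    of x^2 + 4de = N. *)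

(** * Integer vectors with a given sum of squares *)

Lemma leq_size_inj (T U : eqType) (f : T -> U) (s : seq T) (t : seq U) :
  uniq s -> {in s, forall x, f x \in t} -> {in s &, injective f} ->
  size s <= size t.
Proof.
move=> us st inj; rewrite -(size_map f); apply: uniq_leq_size.
  by rewrite map_inj_in_uniq.
by move=> y /mapP[x xs ->]; exact: st.
Qed.

Lemma big_involution (V : nmodType) (T : eqType) (f : T -> T) (s : seq T)
    (P : pred T) (F : T -> V) :
  uniq s -> {in s, forall x, f x \in s} -> {in s, involutive f} ->
  (\sum_(x <- s | P x) F x = \sum_(x <- s | P (f x)) F (f x))%R.
Proof.
move=> us fs fK; rewrite -(big_map f P F); apply: perm_big; apply: uniq_perm => //.
  by rewrite map_inj_in_uniq // => x y xs ys e; rewrite -(fK x) // e fK.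
move=> y; apply/idP/mapP => [ys|[x xs ->]]; last exact: fs.
by exists (f y); rewrite ?fK ?fs.
Qed.

Definition ints (n : nat) : seq int :=
  [seq Posz i | i <- iota 0 n.+1] ++ [seq (- Posz i)%R | i <- iota 1 n].

Lemma mem_ints n x : (x \in ints n) = (`|x| <= n).
Proof.
rewrite mem_cat; apply/orP/idP => [[] /mapP[i]|h].
- by rewrite mem_iota => ? ->; lia.
- by rewrite mem_iota => ? ->; lia.
case: (lerP 0 x) => x0; [left|right]; apply/mapP; exists `|x|%N => //;
  rewrite ?mem_iota; lia.
Qed.

Lemma ints_uniq n : uniq (ints n).
Proof.
rewrite cat_uniq !map_inj_in_uniq ?iota_uniq ?andbT.
- apply/hasPn => x /mapP[i]; rewrite mem_iota => hi ->.
  by apply/mapP => -[j _]; lia.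
- by move=> i j _ _; lia.
- by move=> i j _ _; lia.
Qed.

Definition normsq (v : seq int) : nat := \sum_(x <- v) `|x| ^ 2.

Definition roots_le (n : nat) : seq int := [seq a <- ints n | `|a| ^ 2 <= n].

Lemma mem_roots_le n a : (a \in roots_le n) = (`|a| ^ 2 <= n).
Proof.
rewrite mem_filter mem_ints; case: leqP => //= h.
by rewrite (leq_trans _ h) // expnS expn1; nia.
Qed.

Lemma roots_le_uniq n : uniq (roots_le n).
Proof. by rewrite filter_uniq ?ints_uniq. Qed.

(** The length of this list is r_j(n). The subtraction is exact, since [a] runs over
    [roots_le n]. *)
Fixpoint sq_vecs (j n : nat) : seq (seq int) :=
  if j is j'.+1 then
    [seq a :: v | a <- roots_le n, v <- sq_vecs j' (n - `|a| ^ 2)]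
  else if n == 0 then [:: [::]] else [::].

Lemma sq_vecsS j n :
  sq_vecs j.+1 n = [seq a :: v | a <- roots_le n, v <- sq_vecs j (n - `|a| ^ 2)].
Proof. by []. Qed.

Lemma mem_sq_vecs j n v :
  (v \in sq_vecs j n) = (size v == j) && (normsq v == n).
Proof.
elim: j n v => [|j IH] n v.
  rewrite /=; case: v => [|a v]; last by case: eqP.
  by rewrite /normsq big_nil eq_sym; case: eqP.
rewrite sq_vecsS; apply/allpairsPdep/andP.
  move=> [b [w [hb hw ->]]]; move: hw; rewrite IH => /andP[sw /eqP nw].
  by rewrite /normsq big_cons -/(normsq w) nw subnKC -?mem_roots_le.
case: v => [|a v] [sv] //; rewrite /normsq big_cons -/(normsq v) => /eqP <-.
exists a, v; rewrite mem_roots_le leq_addr IH -eqSS sv /=; split=> //.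
by rewrite addKn.
Qed.

Lemma sq_vecs_uniq j n : uniq (sq_vecs j n).
Proof.
elim: j n => [|j IH] n; first by rewrite /=; case: eqP.
rewrite sq_vecsS; apply: allpairs_uniq_dep; first exact: roots_le_uniq.
  by move=> a _; exact: IH.
by move=> [a v] [b w] _ _ [-> ->].
Qed.

Arguments sq_vecs : simpl never.

Lemma size_sq_vecsS j n :
  size (sq_vecs j.+1 n) = \sum_(a <- roots_le n) size (sq_vecs j (n - `|a| ^ 2)).
Proof. by rewrite sq_vecsS size_allpairs_dep sumnE big_map. Qed.

Definition sigma (n : nat) : nat := \sum_(d <- divisors n) d.

Definition oddz (x : int) := odd `|x|.

(* If n = 1 mod 4, these are the solutions of x^2 + 4de = n with x odd and
   d, e > 0. *)
Definition triples (n : nat) : seq (int * int * int) :=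
  [seq (x, Posz d, Posz ((n - `|x| ^ 2) %/ 4 %/ d)) |
     x <- [seq x <- roots_le n | oddz x], d <- divisors ((n - `|x| ^ 2) %/ 4)].

(** * A divisor sum identity *)

Lemma absz_sqr (x : int) : Posz (`|x| ^ 2) = (x ^+ 2)%R.
Proof. by rewrite -abszX abszE ger0_norm ?sqr_ge0. Qed.

Lemma odd_sqr_mod8 m : odd m -> m ^ 2 %% 8 = 1.
Proof.
move=> om; rewrite -modnXm; have : m %% 8 < 8 by rewrite ltn_mod.
have : odd (m %% 8) by lia.
by case: (m %% 8) => [|[|[|[|[|[|[|[|]]]]]]]].
Qed.

Definition is_triple n (t : int * int * int) :=
  let: (x, d, e) := t in
  [&& oddz x, (0 < d)%R, (0 < e)%R & (x ^+ 2 + 4 * (d * e) == n%:Z)%R].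

(** Odd squares are 1 mod 8, so n - x^2 is 4 mod 8: it is nonzero and its division by 4 is exact. *)
Lemma mem_triples n t : n %% 8 = 5 -> (t \in triples n) = is_triple n t.
Proof.
move=> n5; case: t => [[x d] e]; apply/allpairsPdep/idP.
  move=> [y [k [hy hk [-> -> ->]]]]; move: hy hk.
  rewrite mem_filter mem_roots_le => /andP[oy ly] hk.
  have y8 := odd_sqr_mod8 oy.
  have n0 : 0 < (n - `|y| ^ 2) %/ 4 by lia.
  move: hk; rewrite -dvdn_divisors // => hk.
  have k0 := dvdn_gt0 n0 hk.
  apply/and4P; split=> //.
    by rewrite ltz_nat divn_gt0 // dvdn_leq.
  by have := divnK hk; have := absz_sqr y; move: (_ %/ k) => q; lia.
case/and4P=> ox d0 e0 /eqP E.
have x8 := odd_sqr_mod8 ox.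
have E' : `|x| ^ 2 + 4 * (`|d| * `|e|) = n by have := absz_sqr x; nia.
have E4 : (n - `|x| ^ 2) %/ 4 = `|d| * `|e| by lia.
exists x, `|d|; rewrite mem_filter mem_roots_le E4; split.
- by apply/andP; split => //; lia.
- by rewrite -dvdn_divisors ?dvdn_mulr //; nia.
- by rewrite mulKn; last lia; congr (_, _, _); lia.
Qed.

Lemma triples_uniq n : uniq (triples n).
Proof.
apply: allpairs_uniq_dep.
- by rewrite filter_uniq ?roots_le_uniq.
- by move=> x _; apply: divisors_uniq.
- by move=> [x d] [y e] _ _ [-> ->].
Qed.

(* [swap] exchanges the triples with [pos] and those without it, and preserves
   [G], a symmetrization of [F]; on the former the involution [tau] sends [G]
   to [- G]. *)
Section TripleSum.
Local Open Scope ring_scope.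
Variable n : nat.
Hypothesis n5 : (n %% 8 = 5)%N.

Let S := triples n.
Let F (t : int * int * int) : int := let: (x, d, e) := t in d * (d * e - x ^+ 2).
Let G (t : int * int * int) : int :=
  let: (x, d, e) := t in (d + e) * (d - x) * (e + x).
Let negx (t : int * int * int) := let: (x, d, e) := t in (- x, d, e).
Let swap (t : int * int * int) := let: (x, d, e) := t in (- x, e, d).
Let tau (t : int * int * int) :=
  let: (x, d, e) := t in (2 * d - x, d, e + x - d).
Let pos (t : int * int * int) := let: (x, d, e) := t in 0 < e + x - d.

Let negxS t : t \in S -> negx t \in S.
Proof.
rewrite !mem_triples //; case: t => [[x d] e] /and4P[ox d0 e0 h] /=.
by rewrite /oddz abszN sqrrN; apply/and4P.
Qed.

Let swapS t : t \in S -> swap t \in S.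
Proof.
rewrite !mem_triples //; case: t => [[x d] e] /and4P[ox d0 e0 h] /=.
by rewrite /oddz abszN sqrrN [e * d]mulrC; apply/and4P.
Qed.

(** The norm form is kept by (2d - x)^2 + 4d(e + x - d) = x^2 + 4de, and on the image the condition
    [pos] reads 0 < e. *)
Let tauS t : (t \in [seq t <- S | pos t]) -> tau t \in [seq t <- S | pos t].
Proof.
rewrite !mem_filter !mem_triples //; case: t => [[x d] e] /andP[p].
move=> /and4P[ox d0 e0 /eqP h] /=; rewrite /= in p.
have ox' : oddz (2 * d - x) by move: ox; rewrite /oddz; lia.
rewrite ox' d0 p /=; apply/andP; split; first lia.
apply/eqP; rewrite -h; ring.
Qed.

(** The equality e + x = d is impossible: it would make n = (2d - x)^2 an odd square, hence 1 mod
    8. *)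
Let not_pos t : t \in S -> ~~ pos t = pos (swap t).
Proof.
rewrite mem_triples //; case: t => [[x d] e] /and4P[ox d0 e0 /eqP h] /=.
have ox' : oddz (2 * d - x) by move: ox; rewrite /oddz; lia.
have h8 := odd_sqr_mod8 ox'.
have sq := absz_sqr (2 * d - x).
case: (ltrgtP (e + x - d) 0) => ed; lia.
Qed.

Lemma triple_sum0 : \sum_(t <- S) F t = 0.
Proof.
have us : uniq S := triples_uniq n.
have nK : {in S, involutive negx} by move=> [[x d] e] _ /=; rewrite opprK.
have sK : {in S, involutive swap} by move=> [[x d] e] _ /=; rewrite opprK.
have odd0 : \sum_(t <- S) (let: (x, d, e) := t in x * (d ^+ 2 - e ^+ 2)) = 0.
  set X := \sum_(t <- S) _.
  have : X = - X.
    rewrite {1}/X (big_involution _ _ us negxS nK) -sumrN.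
    by apply: eq_bigr => [[[x d] e]] _ /=; ring.
  lia.
(* Termwise, [G t] is [F t + F (swap t)] plus x(d^2 - e^2), which is odd in x. *)
have GF : \sum_(t <- S) G t = 2 * \sum_(t <- S) F t.
  rewrite mulr2n mulrDl mul1r {2}(big_involution _ F us swapS sK).
  rewrite -[RHS]addr0 -[X in _ = _ + X]odd0 -!big_split /=.
  by apply: eq_bigr => [[[x d] e]] _ /=; ring.
(* [tau] exchanges the factors d + e and e + x of [G] and negates d - x. *)
have Gpos : \sum_(t <- S | pos t) G t = 0.
  set X := \sum_(t <- S | _) _.
  have : X = - X.
    rewrite {1}/X -big_filter (@big_involution _ _ tau) ?filter_uniq //.
      rewrite big_filter -sumrN.
      by apply: eq_bigr => [[[x d] e]] _ /=; ring.
    by move=> [[x d] e] _ /=; congr (_, _, _); ring.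
  lia.
have Gneg : \sum_(t <- S | ~~ pos t) G t = 0.
  rewrite -[RHS]Gpos [RHS](big_involution _ _ us swapS sK).
  rewrite [LHS]big_seq_cond [RHS]big_seq_cond.
  apply: eq_big => [t|[[x d] e] _] /=; last by ring.
  by case: (boolP (t \in S)) => //= /not_pos ->.
have : 2 * \sum_(t <- S) F t = 0.
  by rewrite -GF (bigID pos) /= Gpos Gneg.
lia.
Qed.

Lemma sigma_recurrence :
  \sum_(x <- roots_le n | oddz x)
     (n%:Z - 5 * x ^+ 2) * (sigma ((n - `|x| ^ 2) %/ 4))%:Z = 0.
Proof.
(* From n = x^2 + 4de follows n - 5x^2 = 4(de - x^2). *)
have E : \sum_(t <- S) (let: (x, d, e) := t in (n%:Z - 5 * x ^+ 2) * d) =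
    4 * \sum_(t <- S) F t.
  rewrite mulr_sumr big_seq [RHS]big_seq; apply: eq_bigr => [[[x d] e]].
  by rewrite mem_triples // => /and4P[_ _ _ /eqP <-] /=; ring.
rewrite triple_sum0 mulr0 big_allpairs_dep big_filter in E; rewrite -[RHS]E.
apply: eq_bigr => x _; rewrite /sigma -mulr_sumr; congr (_ * _).
by rewrite (big_morph Posz PoszD (erefl _)).
Qed.
End TripleSum.

(** * Sums of four odd squares *)

Definition vecs_in (P : pred int) (j n : nat) : seq (seq int) :=
  [seq v <- sq_vecs j n | all P v].

Lemma mem_vecs_in P j n v :
  (v \in vecs_in P j n) = [&& all P v, size v == j & normsq v == n].
Proof. by rewrite mem_filter mem_sq_vecs. Qed.

Lemma vecs_in_uniq P j n : uniq (vecs_in P j n).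
Proof. by rewrite filter_uniq ?sq_vecs_uniq. Qed.

Lemma big_vecs_inS (V : nmodType) (F : int -> V) P j n :
  (\sum_(v <- vecs_in P j.+1 n) F (head 0 v) =
   \sum_(a <- roots_le n | P a) F a *+ size (vecs_in P j (n - `|a| ^ 2)))%R.
Proof.
rewrite big_filter sq_vecsS big_mkcond big_allpairs_dep [RHS]big_mkcond /=.
apply: eq_bigr => a _; case: (P a) => /=; last by rewrite big1.
by rewrite -big_mkcond -big_filter big_const_seq count_predT iter_addr_0.
Qed.

Lemma perm_rot_vecs_in P j n :
  perm_eq (map (rot 1) (vecs_in P j n)) (vecs_in P j n).
Proof.
have us := vecs_in_uniq P j n.
have um : uniq (map (rot 1) (vecs_in P j n)).
  by rewrite map_inj_uniq //; apply: rot_inj.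
apply: uniq_perm => //.
have sub : {subset map (rot 1) (vecs_in P j n) <= vecs_in P j n}.
  move=> _ /mapP[v hv ->]; move: hv; rewrite !mem_vecs_in size_rot.
  have pr : perm_eq (rot 1 v) v by rewrite perm_rot.
  by rewrite /normsq (perm_big _ pr) (perm_all _ pr).
by have [|] := uniq_min_size um sub; rewrite ?size_map.
Qed.

(** A rotation permutes the vectors and moves coordinate i + 1 to position i. *)
Lemma big_nth_vecs_in (V : nmodType) (F : int -> V) P j n i : i <= j ->
  (\sum_(v <- vecs_in P j.+1 n) F (nth 0 v i) =
   \sum_(v <- vecs_in P j.+1 n) F (head 0 v))%R.
Proof.
elim: i => [|i IH] ij; first by apply: eq_bigr => v _; rewrite nth0.
rewrite -IH ?(ltnW ij) // -[in RHS](perm_big _ (perm_rot_vecs_in P j.+1 n)).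
rewrite big_map big_seq [RHS]big_seq; apply: eq_bigr => v.
rewrite mem_vecs_in => /and3P[_ /eqP sv _].
case: v sv => // a v [sv].
by rewrite rot1_cons nth_rcons /= sv ij.
Qed.

(* By symmetry each coordinate of the 5-tuples contributes a fifth of [n]. The
   quantities [16 sigma] obey the same recurrence (sigma_recurrence). *)
Lemma odd_vecs_recurrence n :
  (\sum_(a <- roots_le n | oddz a)
     (n%:Z - 5 * a ^+ 2) * (size (vecs_in oddz 4 (n - `|a| ^ 2)))%:Z = 0)%R.
Proof.
have -> : (\sum_(a <- roots_le n | oddz a)
     (n%:Z - 5 * a ^+ 2) * (size (vecs_in oddz 4 (n - `|a| ^ 2)))%:Z =
   \sum_(v <- vecs_in oddz 5 n) (n%:Z - 5 * (head 0 v) ^+ 2))%R.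
  rewrite (big_vecs_inS (fun a => n%:Z - 5 * a ^+ 2)%R); apply: eq_bigr => a _.
  by rewrite -[RHS]mulr_natr; congr (_ * _)%R; rewrite natz.
rewrite sumrB -mulr_sumr; apply/eqP; rewrite subr_eq0; apply/eqP.
rewrite -[X in (X * _)%R]/(5%:R)%R mulr_natl.
have -> : (\sum_(v <- vecs_in oddz 5 n) n%:Z =
  \sum_(v <- vecs_in oddz 5 n) \sum_(0 <= i < 5) (nth 0 v i) ^+ 2)%R.
  rewrite big_seq [RHS]big_seq; apply: eq_bigr => v.
  rewrite mem_vecs_in => /and3P[_ /eqP sv /eqP <-].
  rewrite /normsq (big_nth 0%R) sv (big_morph Posz PoszD (erefl _)).
  by apply: eq_bigr => i _; rewrite absz_sqr.
rewrite exchange_big /= !big_mkord !big_ord_recr big_ord0 /= add0r.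
by rewrite !(@big_nth_vecs_in _ (fun x => x ^+ 2)%R) // !mulrS mulr0n addr0 !addrA.
Qed.

(** Take n = 4u + 1. The difference [D] of the two sides satisfies the common recurrence; its terms
    with |a| >= 3 concern smaller odd numbers and vanish by induction. Only a = 1 and a = -1 remain,
    with coefficient n - 5. *)
Lemma size_odd_vecs u : odd u ->
  size (vecs_in oddz 4 (4 * u)) = 16 * sigma u.
Proof.
elim/ltn_ind: u => u IH ou.
(* For u = 1 the coefficient n - 5 is zero, so this case is computed. *)
case: (ltnP 1 u) => [u1|]; last first.
  by case: u ou {IH} => [|[|u]] //= _ _; rewrite /sigma big_cons big_nil.
pose n := (4 * u).+1.
have n5 : n %% 8 = 5 by rewrite /n; lia.
pose D (a : int) := ((size (vecs_in oddz 4 (n - `|a| ^ 2)))%:Z -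
  16 * (sigma ((n - `|a| ^ 2) %/ 4))%:Z)%R.
have S0 : (\sum_(a <- roots_le n | oddz a) (n%:Z - 5 * a ^+ 2) * D a = 0)%R.
  have e1 := odd_vecs_recurrence n; have e2 := sigma_recurrence n5.
  rewrite -[RHS]addr0 -[in X in (_ + X)%R](mulr0 (-16)%R) -[X in (X + _)%R]e1.
  rewrite -[X in (_ * X)%R]e2 mulr_sumr -big_split /=.
  by apply: eq_bigr => a _; rewrite /D; ring.
have D0 a : a \in roots_le n -> oddz a -> `|a| != 1 -> D a = 0%R.
  rewrite mem_roots_le => la oa a1; have a8 := odd_sqr_mod8 oa.
  have a9 : 9 <= `|a| ^ 2.
    by rewrite (_ : 9 = 3 ^ 2) // leq_exp2r //; move: oa; rewrite /oddz; lia.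
  rewrite /D; set w := (n - _) %/ 4.
  have -> : n - `|a| ^ 2 = 4 * w by rewrite /w; lia.
  by rewrite IH /w; lia.
have [r1 rm1] : (1%R \in roots_le n) /\ ((-1)%R \in roots_le n).
  by rewrite !mem_roots_le.
have E : (2 * ((n%:Z - 5) * D 1) = 0)%R.
  have pm : perm_eq [seq a <- roots_le n | oddz a && (`|a| == 1)] [:: 1%R; (-1)%R].
    apply: uniq_perm => //; first exact: filter_uniq (roots_le_uniq n).
    move=> a.
    rewrite mem_filter !inE; apply/idP/idP => [/andP[/andP[_ a1] _]|]; first lia.
    by case/orP=> /eqP ->; rewrite ?r1 ?rm1.
  have Z : (\sum_(a <- roots_le n | oddz a && (`|a| != 1%N))
              (n%:Z - 5 * a ^+ 2) * D a = 0)%R.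
    rewrite big_seq_cond big1 // => a /and3P[ha oa a1].
    by rewrite D0 ?mulr0.
  rewrite -[RHS]S0 (bigID (fun a => `|a| == 1)) /= Z.
  by rewrite -big_filter (perm_big _ pm) !big_cons big_nil /D /=; ring.
have D10 : D 1%R = 0%R by rewrite /n in E; nia.
by move: D10; rewrite /D /n /= subn1 /= mulKn //; lia.
Qed.

(** * Jacobi's formula for odd numbers *)

Lemma normsq4 (x y z w : int) :
  Posz (normsq [:: x; y; z; w]) = (x ^+ 2 + y ^+ 2 + z ^+ 2 + w ^+ 2)%R.
Proof.
by rewrite /normsq !big_cons big_nil addn0 !PoszD !absz_sqr !addrA.
Qed.

Lemma size4P (T : Type) (v : seq T) :
  size v == 4 -> exists x y z w, v = [:: x; y; z; w].
Proof. by case: v => [|x [|y [|z [|w []]]]] // _; exists x, y, z, w. Qed.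

(** Replacing squares by a multiple of 4 plus a parity bit makes parity arguments about sums of
    squares linear. *)
Lemma sqr_mod4 (x : int) : (exists b : int, x ^+ 2 = 4 * b + (oddz x)%:Z)%R.
Proof.
have [k hk] : (exists k, x = 2 * k + (oddz x)%:Z)%R.
  by exists (x %/ 2)%Z; rewrite /oddz; case: (boolP (odd _)); lia.
by case: (oddz x) hk => -> /=; [exists (k ^+ 2 + k)%R | exists (k ^+ 2)%R]; ring.
Qed.

Lemma oddzD (x y : int) : oddz (x + y)%R = oddz x (+) oddz y.
Proof. by rewrite /oddz; lia. Qed.

Section Hadamard.
Local Open Scope ring_scope.
Variable u : nat.
Hypothesis ou : odd u.

(* Four times the inverse of the Hadamard map [had] is [had] itself, so [had]
   identifies the vectors of norm [u] with the odd vectors of norm [4 * u] whose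
   coordinates add up to a multiple of 4, that is, with half of the latter. *)
Let had (v : seq int) : seq int :=
  if v is [:: x; y; z; w] then
    [:: x + y + z + w; x + y - z - w; x - y + z - w; x - y - z + w]
  else v.
Let had4 (v : seq int) : seq int :=
  if v is [:: x; y; z; w] then
    [:: ((x + y + z + w) %/ 4)%Z; ((x + y - z - w) %/ 4)%Z;
        ((x - y + z - w) %/ 4)%Z; ((x - y - z + w) %/ 4)%Z]
  else v.
Let neg1 (v : seq int) : seq int :=
  if v is [:: x; y; z; w] then [:: - x; y; z; w] else v.
Let sum4 (v : seq int) : bool :=
  if v is [:: x; y; z; w] then ((x + y + z + w) %% 4)%Z == 0 else false.
Let K := vecs_in oddz 4 (4 * u).

Lemma size_sq_vecs4_odd : (2 * size (sq_vecs 4 u) = size K)%N.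
Proof.
have uK : uniq K by exact: vecs_in_uniq.
have inK v : (v \in K) = [&& all oddz v, size v == 4%N & normsq v == (4 * u)%N].
  exact: mem_vecs_in.
have inF P v : (v \in filter P K) = P v && (v \in K) by exact: mem_filter.
rewrite -(count_predC sum4 K) mul2n -addnn -!size_filter.
have le1 : (size (sq_vecs 4 u) <= size (filter sum4 K))%N.
  apply: (@leq_size_inj _ _ had); first exact: sq_vecs_uniq.
    move=> v; rewrite mem_sq_vecs => /andP[/size4P[x [y [z [w ->]]]] /eqP nv].
    have nv' := normsq4 x y z w; rewrite nv in nv'.
    rewrite inF inK /=; apply/and3P; split; first lia.
      (* The coordinate sum has the parity of [u], and sign changes preserve parity, so all four
         image coordinates are odd. *)
      have : oddz (x + y + z + w).
        rewrite !oddzD; move: nv'.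
        have [a ->] := sqr_mod4 x; have [b ->] := sqr_mod4 y.
        have [c ->] := sqr_mod4 z; have [d ->] := sqr_mod4 w.
        case: (oddz x) (oddz y) (oddz z) (oddz w) => [] [] [] [] //=; clear -ou; lia.
      by rewrite /oddz => oS; apply/and5P; split; lia.
    by rewrite -(eqr_nat int) !natz PoszM nv' normsq4; apply/eqP; ring.
  move=> v w; rewrite !mem_sq_vecs => /andP[/size4P[x [y [z [t ->]]]] _].
  by move=> /andP[/size4P[x' [y' [z' [t' ->]]]] _] /= [] *; congr [:: _; _; _; _]; lia.
have le2 : (size (filter sum4 K) <= size (sq_vecs 4 u))%N.
  apply: (@leq_size_inj _ _ had4); first exact: filter_uniq.
    move=> v; rewrite inF inK mem_sq_vecs.
    move=> /and4P[s4 ov /size4P[x [y [z [w E]]]] /eqP nv].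
    move: s4 ov nv; rewrite {}E /= => s4 /and5P[ox oy oz ow _] nv.
    have nv' := normsq4 x y z w; rewrite nv in nv'.
    rewrite /oddz in ox oy oz ow.
    set X := ((x + y + z + w) %/ 4)%Z; set Y := (_ %/ 4)%Z.
    set Z := (_ %/ 4)%Z; set W := (_ %/ 4)%Z.
    (* Negating two odd coordinates changes the sum by a multiple of 4, so all four divisions are
       exact. *)
    have [e1 e2 e3 e4] : [/\ x = X + Y + Z + W, y = X + Y - Z - W,
        z = X - Y + Z - W & w = X - Y - Z + W] by rewrite /X /Y /Z /W; split; lia.
    move: nv'; rewrite -(eqr_nat int) !natz normsq4 e1 e2 e3 e4 => nv'.
    apply/eqP; apply: (@mulfI _ 4) => //; rewrite -PoszM nv'; ring.
  move=> v w; rewrite !inF !inK.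
  move=> /and4P[sv ov /size4P[x [y [z [t E]]]] _]; move: sv ov; rewrite {}E /=.
  move=> sv /and5P[ox oy oz ow _].
  move=> /and4P[sw ov /size4P[x' [y' [z' [t' E]]]] _]; move: sw ov; rewrite {}E /=.
  move=> sw /and5P[ox' oy' oz' ow' _] [].
  rewrite /oddz in ox oy oz ow ox' oy' oz' ow' *; move=> *.
  by congr [:: _; _; _; _]; lia.
have neg_inj : {in K &, injective neg1}.
  move=> v w; rewrite !inK => /and3P[_ /size4P[x [y [z [t ->]]]] _].
  by move=> /and3P[_ /size4P[x' [y' [z' [t' ->]]]] _] /= [/oppr_inj -> -> -> ->].
(* Negating an odd coordinate shifts the sum, which is even, by 2 mod 4. *)
have negK v : v \in K -> (neg1 v \in K) && (sum4 (neg1 v) == ~~ sum4 v).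
  rewrite !inK => /and3P[ov /size4P[x [y [z [t E]]]] /eqP nv].
  move: ov nv; rewrite {}E /= => /and5P[ox oy oz ow _] <-.
  rewrite {1}/oddz abszN -/(oddz x) ox oy oz ow /= /normsq !big_cons abszN eqxx /=.
  by rewrite /oddz in ox oy oz ow; apply/eqP; lia.
have le3 : (size (filter sum4 K) <= size (filter (predC sum4) K))%N.
  apply: (@leq_size_inj _ _ neg1); first exact: filter_uniq.
    move=> v; rewrite !inF => /andP[sv /negK/andP[-> /eqP] /=].
    by rewrite sv => ->.
  by move=> v w; rewrite !inF => /andP[_ ?] /andP[_ ?]; exact: neg_inj.
have le4 : (size (filter (predC sum4) K) <= size (filter sum4 K))%N.
  apply: (@leq_size_inj _ _ neg1); first exact: filter_uniq.
    by move=> v; rewrite !inF /= => /andP[sv /negK/andP[-> /eqP ->]]; rewrite sv.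
  by move=> v w; rewrite !inF => /andP[_ ?] /andP[_ ?]; exact: neg_inj.
lia.
Qed.
End Hadamard.

Lemma four_squares_odd u : odd u -> size (sq_vecs 4 u) = 8 * sigma u.
Proof. by move=> ou; have := size_sq_vecs4_odd ou; rewrite size_odd_vecs //; lia. Qed.

(** * Upper bounds for the number of sums of four squares *)

Section Doubling.
Local Open Scope ring_scope.
Variable k : nat.

(* Among four integers with even sum of squares some pairing matches parities. *)
Let half (v : seq int) : seq int :=
  if v is [:: x; y; z; w] then
    [:: ((x + y) %/ 2)%Z; ((x - y) %/ 2)%Z; ((z + w) %/ 2)%Z; ((z - w) %/ 2)%Z]
  else v.
Let ev (v : seq int) : bool :=
  if v is [:: x; y; z; w] then ~~ oddz (x + y) && ~~ oddz (z + w) else false.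
Let sw2 (v : seq int) : seq int :=
  if v is [:: x; y; z; w] then [:: x; z; y; w] else v.
Let sw3 (v : seq int) : seq int :=
  if v is [:: x; y; z; w] then [:: x; w; z; y] else v.
Let L := sq_vecs 4 (2 * k).

Let inL v : v \in L -> exists x y z w,
  v = [:: x; y; z; w] /\ x ^+ 2 + y ^+ 2 + z ^+ 2 + w ^+ 2 = 2 * k%:Z.
Proof.
rewrite mem_sq_vecs => /andP[/size4P[x [y [z [w ->]]]] /eqP nv].
by exists x, y, z, w; rewrite -normsq4 nv.
Qed.

(** The norm is halved by ((x + y)/2)^2 + ((x - y)/2)^2 = (x^2 + y^2)/2. The map [s] rearranges the
    coordinates to select a pairing. *)
Let size_ev (s : seq int -> seq int) :
  {in L, forall v, s v \in L} -> {in L &, injective s} ->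
  (size (filter (ev \o s) L) <= size (sq_vecs 4 k))%N.
Proof.
move=> sL sI; apply: (@leq_size_inj _ _ (half \o s)).
- by rewrite filter_uniq ?sq_vecs_uniq.
- move=> v; rewrite mem_filter => /andP[/= e /sL] /=.
  move: (s v) e => {sI}w0 e /inL[x [y [z [w [E nv]]]]].
  move: e; rewrite {}E mem_sq_vecs /= => /andP[exy ezw].
  set a := (_ %/ 2)%Z; set b := (_ %/ 2)%Z.
  set c := (_ %/ 2)%Z; set d := (_ %/ 2)%Z.
  have [e1 e2 e3 e4] : [/\ x = a + b, y = a - b, z = c + d & w = c - d].
    by rewrite /oddz in exy ezw; rewrite /a /b /c /d; split; lia.
  rewrite e1 e2 e3 e4 in nv; rewrite -(eqr_nat int) !natz normsq4; apply/eqP.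
  by apply: (@mulfI _ 2) => //; rewrite -nv; ring.
move=> v w; rewrite !mem_filter => /= /andP[ev' vL] /andP[ew wL] h.
apply: sI => //; move: h ev' ew; have := sL _ wL; have := sL _ vL.
move: (s v) (s w) => v' w' /inL[x [y [z [t [-> _]]]]].
move=> /inL[x' [y' [z' [t' [-> _]]]]] /= [e1 e2 e3 e4] /andP[o1 o2] /andP[o3 o4].
by rewrite /oddz in o1 o2 o3 o4; congr [:: _; _; _; _]; lia.
Qed.

Let size_id : (size (filter ev L) <= size (sq_vecs 4 k))%N.
Proof. exact: (@size_ev id). Qed.

Let size_sw2 : (size (filter (ev \o sw2) L) <= size (sq_vecs 4 k))%N.
Proof.
apply: size_ev.
  move=> v vL; have [x [y [z [w [E nv]]]]] := inL vL.
  by rewrite E mem_sq_vecs /= -(eqr_nat int) !natz normsq4 PoszM -nv; apply/eqP; ring.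
move=> v w /inL[x [y [z [t [-> _]]]]] /inL[x' [y' [z' [t' [-> _]]]]].
by case=> -> -> -> ->.
Qed.

Let size_sw3 : (size (filter (ev \o sw3) L) <= size (sq_vecs 4 k))%N.
Proof.
apply: size_ev.
  move=> v vL; have [x [y [z [w [E nv]]]]] := inL vL.
  by rewrite E mem_sq_vecs /= -(eqr_nat int) !natz normsq4 PoszM -nv; apply/eqP; ring.
move=> v w /inL[x [y [z [t [-> _]]]]] /inL[x' [y' [z' [t' [-> _]]]]].
by case=> -> -> -> ->.
Qed.

Lemma four_squares_double : (size L <= 3 * size (sq_vecs 4 k))%N.
Proof.
apply: (@leq_trans (count ev L + count (ev \o sw2) L + count (ev \o sw3) L)%N).
  have h : all (fun v => ev v || (ev \o sw2) v || (ev \o sw3) v) L.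
    apply/allP => v /inL[x [y [z [w [-> nv]]]]] /=.
    rewrite !oddzD; move: nv.
    have [a ->] := sqr_mod4 x; have [b ->] := sqr_mod4 y.
    have [c ->] := sqr_mod4 z; have [d ->] := sqr_mod4 w.
    case: (oddz x) (oddz y) (oddz z) (oddz w) => [] [] [] [] //=; clear; lia.
  elim: L h => //= v s IH /andP[h /IH]; move: h.
  by case: (ev v); case: (ev (sw2 v)); case: (ev (sw3 v)) => //=; lia.
by rewrite -!size_filter; lia.
Qed.

(** The norm is now divisible by 4, so the number of odd coordinates is 0 or 4 and the first pairing
    always matches parities. *)
Lemma four_squares_double_even : ~~ odd k -> (size L <= size (sq_vecs 4 k))%N.
Proof.
move=> ek; suff -> : L = filter ev L by exact: size_id.
apply/esym/all_filterP/allP => v /inL[x [y [z [w [-> nv]]]]] /=.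
move: nv ek; rewrite !oddzD.
have [a ->] := sqr_mod4 x; have [b ->] := sqr_mod4 y.
have [c ->] := sqr_mod4 z; have [d ->] := sqr_mod4 w.
by case: (oddz x) (oddz y) (oddz z) (oddz w) => [] [] [] [] //=; clear; lia.
Qed.
End Doubling.

(** Halve [n] down to its odd part [u]. Only the last halving, from 2u to u, costs a factor 3;
    Jacobi's formula supplies the 8 in 24 = 3 * 8. *)
Lemma four_squares_even n : 0 < n -> ~~ odd n ->
  exists u, [/\ odd u, 2 * u <= n & size (sq_vecs 4 n) <= 24 * sigma u].
Proof.
elim/ltn_ind: n => n IH n0 en.
have [k nk] : exists k, n = 2 * k by exists n./2; lia.
have [ok|ek] := boolP (odd k).
  exists k; rewrite {1}nk; split=> //.
  by have := four_squares_double k; rewrite -nk (four_squares_odd ok); lia.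
have [u [ou uk su]] : exists u,
    [/\ odd u, 2 * u <= k & size (sq_vecs 4 k) <= 24 * sigma u].
  by apply: IH; [lia | lia | exact: ek].
exists u; split=> //; first lia.
by rewrite nk; apply: leq_trans (four_squares_double_even ek) su.
Qed.

Lemma leq_sum_uniq (T : eqType) (F : T -> nat) (s t : seq T) (P Q : pred T) :
  uniq s -> uniq t -> {in s, forall x, P x -> (x \in t) && Q x} ->
  \sum_(x <- s | P x) F x <= \sum_(x <- t | Q x) F x.
Proof.
move=> us ut st; apply: (@uniq_sub_le_big_cond _ addn leq) => //.
- by move=> x y; apply: leq_addr.
- by rewrite filter_uniq.
- by rewrite filter_uniq.
- by move=> x; rewrite !mem_filter => /andP[Px xs]; rewrite andbC st.
Qed.

(** The constant 49 exceeds 26(1 + 1/3 + ... + 1/11). Each later odd e is at least 13 and adds at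
    most 2u to the left side. *)
Lemma odd_reciprocal_sum u r :
  26 * \sum_(0 <= e < r.+1 | odd e) u %/ e <= (49 + r) * u.
Proof.
elim/ltn_ind: r => r IH; case: (ltnP r 13) => r13.
  apply: (@leq_trans (26 * \sum_(0 <= e < 13 | odd e) u %/ e)).
    rewrite leq_mul2l /= leq_sum_uniq ?iota_uniq // => e.
    by rewrite !mem_index_iota; lia.
  rewrite !big_mkcond !big_nat_recr //= big_geq //; lia.
(* A step of two adds exactly one odd index. *)
have -> : r = r.-2.+2 by lia.
have := IH r.-2; rewrite big_mkcond [in X in _ -> X]big_mkcond => /(_ ltac:(lia)).
rewrite !(big_nat_recr _.+1) //=.
have q13 := leq_trunc_div u 13.
have q1 e : 12 <= e -> odd e -> u %/ e <= u %/ 13.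
  by move=> e12 oe; apply: leq_div2l; lia.
by case: (boolP (odd r.-2)) => /= o; [have := q1 r.-2.+2 | have := q1 r.-2.+1]; lia.
Qed.

(* Divisors above [r] are paired with the odd codivisors [e <= r]; up to 11
   these are summed explicitly, and [u / e <= u / 13] afterwards. *)
Lemma sigma_bound u r : odd u -> r ^ 2 <= u < r.+1 ^ 2 ->
  26 * sigma u <= (75 + r) * u.
Proof.
move=> ou /andP[ru ur]; have u0 : 0 < u by lia.
rewrite /sigma (bigID (fun d => d <= r)) /=.
(* At most [r] divisors, each at most [r], give at most r^2 <= u. This contributes the 26 in 75 = 49
   + 26. *)
have s1 : \sum_(d <- divisors u | d <= r) d <= u.
  apply: leq_trans ru.
  apply: (@leq_trans (\sum_(1 <= d < r.+1) d)).
    apply: leq_sum_uniq; rewrite ?divisors_uniq ?iota_uniq // => d.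
    rewrite -dvdn_divisors // mem_index_iota => du dr.
    by rewrite (dvdn_gt0 u0 du) ltnS dr.
  apply: (@leq_trans (\sum_(1 <= d < r.+1) r)).
    by rewrite big_nat [X in _ <= X]big_nat; apply: leq_sum => d; lia.
  by rewrite sum_nat_const_nat subn1 /= mulnn.
have s2 : \sum_(d <- divisors u | ~~ (d <= r)) d <=
          \sum_(0 <= e < r.+1 | odd e) u %/ e.
  rewrite (@big_involution nat _ (fun d => u %/ d)) ?divisors_uniq //.
  - apply: leq_sum_uniq; rewrite ?divisors_uniq ?iota_uniq // => d.
    rewrite -dvdn_divisors // mem_index_iota => du.
    rewrite -ltnNge => h; rewrite (dvdn_odd du ou) andbT leq0n /=.
    have := divnK du; nia.
  - by move=> d; rewrite -!dvdn_divisors // => du; apply: dvdn_div.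
  - move=> d; rewrite -dvdn_divisors // => du.
    have q0 : 0 < u %/ d by rewrite divn_gt0 ?(dvdn_gt0 u0 du) // dvdn_leq.
    by rewrite -{1}(divnK du) mulKn.
have := odd_reciprocal_sum u r; lia.
Qed.

(** * From vectors to partitions *)

Lemma vecs_in_predT j n : vecs_in predT j n = sq_vecs j n.
Proof.
rewrite /vecs_in (@eq_filter _ _ predT) ?filter_predT // => v.
by rewrite all_predT.
Qed.

(** A union bound over the position of a zero: deleting it leaves a vector of length [j], and by
    symmetry all positions count alike. *)
Lemma count_zero_coord j n :
  count (fun v => 0%R \in v) (sq_vecs j.+1 n) <= j.+1 * size (sq_vecs j n).
Proof.
have coord i : i <= j ->
    \sum_(v <- sq_vecs j.+1 n) ((nth 0%R v i == 0%R) : nat) = size (sq_vecs j n).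
  move=> ij; rewrite -!vecs_in_predT.
  rewrite (@big_nth_vecs_in _ (fun a : int => (a == 0%R) : nat)) //.
  rewrite (@big_vecs_inS _ (fun a : int => (a == 0%R) : nat)).
  rewrite (bigD1_seq 0%R) ?roots_le_uniq ?mem_roots_le //= subn0.
  rewrite big1 ?addr0 ?mul1n => [|a /negbTE ->]; last by rewrite mul0rn.
  by rewrite natn.
rewrite -sum1_count big_mkcond /=.
apply: (@leq_trans (\sum_(v <- sq_vecs j.+1 n)
                      \sum_(0 <= i < j.+1) ((nth 0%R v i == 0%R) : nat))).
  rewrite big_seq [X in _ <= X]big_seq; apply: leq_sum => v.
  rewrite mem_sq_vecs => /andP[/eqP sv _]; case: ifP => // /(nthP 0%R)[i].
  rewrite sv => ij vi; rewrite (bigD1_seq i) ?iota_uniq ?mem_index_iota //= vi eqxx.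
  by [].
rewrite exchange_big /= big_nat (eq_bigr (fun=> size (sq_vecs j n))).
  by rewrite -big_nat sum_nat_const_nat subn0.
by move=> i /andP[_ ij]; apply: coord.
Qed.

Lemma size_permutations_le (T : eqType) (s : seq T) :
  size (permutations s) <= (size s)`!.
Proof.
move Em: (size s) => m; elim: m s Em => [|m IH] s sm.
  by rewrite (size0nil sm).
rewrite (perm_size (permutationsE _)) ?sm // size_allpairs_dep sumnE big_map.
apply: (@leq_trans (\sum_(x <- undup s) m`!)).
  rewrite big_seq [X in _ <= X]big_seq; apply: leq_sum => x.
  by rewrite mem_undup => xs; apply: IH; rewrite size_rem // sm.
rewrite big_const_seq count_predT iter_addn_0 mulnC factS leq_mul2r -sm size_undup.
by rewrite orbT.
Qed.

Definition partition_list (n j : nat) : seq (seq nat) :=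
  [seq map val (t : j.-tuple 'I_n.+1) | t <- enum (square_partitions n j)].

Lemma size_partition_list n j : size (partition_list n j) = p2 n j.
Proof. by rewrite size_map -cardE. Qed.

Lemma partition_list_uniq n j : uniq (partition_list n j).
Proof.
rewrite map_inj_uniq ?enum_uniq // => t u /(inj_map val_inj); exact: val_inj.
Qed.

Lemma mem_partition_list n j s :
  reflect [/\ size s = j, sorted geq s, all pos_square s & sumn s = n]
          (s \in partition_list n j).
Proof.
apply: (iffP mapP) => [[t]|].
  rewrite mem_enum => ht ->; apply/square_partitionsP; by exists t.
by move=> /square_partitionsP[t ht <-]; exists t; rewrite ?mem_enum.
Qed.

(** A vector is determined by its signs and its list of squares. Without zeros, that list rearranges
    a partition of [n] into [j] positive squares. *)
Lemma count_nonzero_vecs j n :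
  count (fun v => 0%R \notin v) (sq_vecs j n) <= 2 ^ j * j`! * p2 n j.
Proof.
pose B := [seq val t | t <- enum {: j.-tuple bool}].
pose Q := flatten [seq permutations s | s <- partition_list n j].
pose f (v : seq int) := (map (fun x => 0 <= x)%R v, map (fun x => `|x| ^ 2) v).
apply: (@leq_trans (size [seq (b, q) | b <- B, q <- Q])).
  rewrite -size_filter; apply: (@leq_size_inj _ _ f).
  - by rewrite filter_uniq ?sq_vecs_uniq.
  - move=> v; rewrite mem_filter mem_sq_vecs => /and3P[v0 /eqP sv /eqP nv].
    apply/allpairsP; exists (f v); split=> //.
      have sb : size (f v).1 == j by rewrite size_map sv.
      by apply/mapP; exists (Tuple sb); rewrite ?mem_enum.
    apply/flatten_mapP; exists (sort geq (f v).2); last first.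
      by rewrite mem_permutations perm_sym perm_sort.
    apply/mem_partition_list; split.
    + by rewrite size_sort size_map.
    + by apply: sort_sorted => x y; apply: leq_total.
    + rewrite all_sort; apply/allP => _ /mapP[x xv ->]; apply/pos_squareP.
      exists `|x|%N => //; rewrite absz_gt0; apply: contraNneq v0 => <- //.
    + by rewrite sumnE (perm_big _ (permEl (perm_sort _ _))) /= big_map.
  - move=> v w _ _ [] h1 h2.
    elim: v w h1 h2 => [|x v IH] [|y w] //= [xy h1] [xy2 h2].
    congr (_ :: _); last exact: IH.
    have : `|x|%N = `|y|%N by apply/eqP; rewrite -(eqn_exp2r _ _ (isT : 0 < 2)) xy2.
    lia.
rewrite size_allpairs -mulnA leq_mul //.
  by rewrite size_map -cardE card_tuple card_bool.
rewrite size_flatten /shape -map_comp sumnE big_map -size_partition_list.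
apply: (@leq_trans (\sum_(s <- partition_list n j) j`!)).
  rewrite big_seq [X in _ <= X]big_seq; apply: leq_sum => s.
  case/mem_partition_list=> [<- _ _ _].
  exact: size_permutations_le.
by rewrite big_const_seq count_predT iter_addn_0 mulnC.
Qed.

Lemma sq_vecs_split j n :
  size (sq_vecs j.+1 n) <=
    j.+1 * size (sq_vecs j n) + 2 ^ j.+1 * (j.+1)`! * p2 n j.+1.
Proof.
rewrite -(count_predC (fun v => 0%R \in v)) leq_add ?count_zero_coord //.
exact: count_nonzero_vecs.
Qed.

(** * Tabulating partitions into squares *)

(** Partitions of [n] into [j] squares of integers in [1, k], largest part first, split by whether
    k^2 occurs. As k^2 may recur, the second branch lowers only [j], whence the inner [fix]. *)
Fixpoint sq_parts (k : nat) : nat -> nat -> seq (seq nat) :=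
  if k is k'.+1 then
    fix aux (j n : nat) : seq (seq nat) :=
      if j is j'.+1 then
        sq_parts k' j n ++
        (if k ^ 2 <= n then [seq k ^ 2 :: s | s <- aux j' (n - k ^ 2)] else [::])
      else if n == 0 then [:: [::]] else [::]
  else fun j n => if (j == 0) && (n == 0) then [:: [::]] else [::].

Lemma sq_parts0 k n : sq_parts k 0 n = if n == 0 then [:: [::]] else [::].
Proof. by case: k. Qed.

Lemma sq_partsSS k j n : sq_parts k.+1 j.+1 n =
  sq_parts k j.+1 n ++
  (if k.+1 ^ 2 <= n
   then [seq k.+1 ^ 2 :: s | s <- sq_parts k.+1 j (n - k.+1 ^ 2)] else [::]).
Proof. by []. Qed.

Arguments sq_parts : simpl never.

Lemma mem_sq_parts k j n s : (s \in sq_parts k j n) =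
  [&& size s == j, sorted geq s, all pos_square s, all (leq^~ (k ^ 2)) s & sumn s == n].
Proof.
elim: k j n s => [|k IHk] j n s.
  rewrite /sq_parts; case: s => [|m s] /=.
    by case: j n => [|j] [|n].
  have -> : (m :: s \in if (j == 0) && (n == 0) then [:: [::]] else [::]) = false.
    by case: ifP.
  by case: m => [|m]; rewrite /= ?andbF.
elim: j n s => [|j IHj] n s.
  rewrite sq_parts0; case: s => [|m s] /=; last by case: eqP.
  by rewrite eq_sym; case: eqP.
rewrite sq_partsSS mem_cat IHk.
have kk : k ^ 2 <= k.+1 ^ 2 by rewrite leq_exp2r.
apply/orP/and5P => [[/and5P[-> -> -> a ->]|]|[sz so ps a su]].
- by split=> //; apply: sub_all a => m; move/leq_trans; apply.
- case: ifP => // kn /mapP[t]; rewrite IHj => /and5P[/eqP sz so ps a /eqP su] ->.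
  split; rewrite /= ?sz ?leqnn ?a ?ps ?andbT //.
  + by rewrite path_min_sorted // (eq_all (a2 := leq^~ (k.+1 ^ 2))).
  + by apply/pos_squareP; exists k.+1.
  + by rewrite su subnKC.
case: s sz so ps a su => [|m s] //= sz so /andP[pm ps] /andP[mk a] su.
have [mE|mnk] := eqVneq m (k.+1 ^ 2).
  right; rewrite -mE -(eqP su) leq_addr; apply/mapP; exists s => //.
  by rewrite addKn IHj -eqSS sz ps a (path_sorted so) eqxx.
left; rewrite sz so pm ps su /= andbT.
(* No square lies strictly between k^2 and (k + 1)^2. *)
have mk' : m <= k ^ 2.
  have /pos_squareP[r r0 rE] := pm; move: mnk mk; rewrite rE eqn_exp2r //.
  by rewrite !leq_exp2r //; lia.
rewrite mk'; apply/allP => x xs; apply: leq_trans mk'.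
by move: so; rewrite (path_sortedE (rev_trans leq_trans)) => /andP[/allP/(_ x xs)].
Qed.

Lemma sq_parts_uniq k j n : uniq (sq_parts k j n).
Proof.
elim: k j n => [|k IHk] j n; first by rewrite /sq_parts; case: ifP.
elim: j n => [|j IHj] n; first by rewrite sq_parts0; case: ifP.
rewrite sq_partsSS cat_uniq IHk /=; case: ifP => // kn.
rewrite map_inj_uniq ?IHj ?andbT; last by move=> s t [].
apply/hasPn => _ /mapP[s _ ->]; rewrite mem_sq_parts /=.
by rewrite leq_exp2r // ltnn !andbF.
Qed.

Lemma p2_sq_parts k j n : n < k.+1 ^ 2 -> p2 n j = size (sq_parts k j n).
Proof.
move=> nk; rewrite -size_partition_list; apply: perm_size; apply: uniq_perm.
- exact: partition_list_uniq.
- exact: sq_parts_uniq.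
move=> s; rewrite mem_sq_parts; apply/mem_partition_list/and5P.
  case=> sz so ps su; split=> //; rewrite ?sz ?su //.
  apply/allP => m ms; have mn : m <= n.
    by rewrite -su sumnE (big_rem m) //= leq_addr.
  have /pos_squareP[r r0 E] := allP ps m ms.
  by move: (leq_ltn_trans mn nk); rewrite E ltn_exp2r // leq_exp2r.
by case=> /eqP sz so ps _ /eqP su.
Qed.

(* Dynamic programming: row [j] after stage [k] tabulates, for all [n] below the
   length of the table, the number of ways to write [n] as a sum of [j] squares
   of integers in [1, k]; [f] is the row for one summand fewer. *)
Definition addN (x y : N) : N :=
  match x, y with
  | N0, _ => y
  | _, N0 => x
  | Npos p, Npos q => Npos (Pos.add p q)
  end.

Lemma nat_of_addN x y : nat_of_bin (addN x y) = nat_of_bin x + nat_of_bin y.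
Proof. by case: x y => [|p] [|q] //=; rewrite ?addn0 // nat_of_add_pos. Qed.

(** The result keeps the length of [s]: the shifted row added in [next_rows] may overrun the table
    and is cut off. *)
Fixpoint add_row (s t : seq N) : seq N :=
  match s, t with
  | x :: s', y :: t' => addN x y :: add_row s' t'
  | _, _ => s
  end.

(** The updated row [g'], not [g], is passed on, because k^2 may be used repeatedly. *)
Fixpoint next_rows (k : nat) (f : seq N) (rows : seq (seq N)) : seq (seq N) :=
  if rows is g :: rows' then
    let g' := add_row g (ncons (k * k) N0 f) in g' :: next_rows k g' rows'
  else [::].

Fixpoint all_rows (k m : nat) (f : seq N) (rows : seq (seq N)) : seq (seq N) :=
  if m is m'.+1 then all_rows k.+1 m' f (next_rows k.+1 f rows) else rows.

Definition empty_sum_row (l : nat) : seq N :=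
  mkseq (fun n => if n is 0 then Npos xH else N0) l.

Definition row_spec (l k j : nat) (r : seq N) : Prop :=
  size r = l /\ forall n, n < l -> nat_of_bin (nth N0 r n) = size (sq_parts k j n).

Lemma size_add_row s t : size (add_row s t) = size s.
Proof. by elim: s t => [|x s IH] [|y t] //=; rewrite IH. Qed.

Lemma nth_add_row s t n : n < size s ->
  nat_of_bin (nth N0 (add_row s t) n) =
  nat_of_bin (nth N0 s n) + nat_of_bin (nth N0 t n).
Proof.
elim: s t n => [|x s IH] [|y t] [|n] //=; rewrite ?nth_nil ?addn0 ?ltnS //.
  by rewrite nat_of_addN.
exact: IH.
Qed.

Lemma empty_sum_row_spec l k : row_spec l k 0 (empty_sum_row l).
Proof.
split=> [|n nl]; first by rewrite size_mkseq.
by rewrite nth_mkseq // sq_parts0; case: n nl.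
Qed.

Lemma add_row_spec l k j f g : row_spec l k.+1 j f -> row_spec l k j.+1 g ->
  row_spec l k.+1 j.+1 (add_row g (ncons (k.+1 * k.+1) N0 f)).
Proof.
move=> [sf hf] [sg hg]; split=> [|n nl]; first by rewrite size_add_row.
rewrite nth_add_row ?sg // hg // nth_ncons mulnn sq_partsSS size_cat.
case: ltnP => nk /=; first by [].
by rewrite size_map hf // (leq_ltn_trans (leq_subr _ _) nl).
Qed.

Lemma next_rows_spec l k j f rows : row_spec l k.+1 j f ->
  (forall i, i < size rows -> row_spec l k (j + i).+1 (nth [::] rows i)) ->
  size (next_rows k.+1 f rows) = size rows /\ forall i, i < size rows ->
    row_spec l k.+1 (j + i).+1 (nth [::] (next_rows k.+1 f rows) i).
Proof.
elim: rows j f => [|g rows IH] j f hf hr //=.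
have hg : row_spec l k j.+1 g by have := hr 0 isT; rewrite addn0.
have {}hg := add_row_spec hf hg.
have [|-> h] := IH j.+1 _ hg.
  by move=> i ir; have := hr i.+1 ir; rewrite addSnnS.
split=> // -[|i] ir /=; first by rewrite addn0.
by rewrite addnS -addSn; apply: h.
Qed.

Lemma all_rows_spec l k m rows :
  (forall i, i < size rows -> row_spec l k i.+1 (nth [::] rows i)) ->
  forall i, i < size rows ->
    row_spec l (k + m) i.+1 (nth [::] (all_rows k m (empty_sum_row l) rows) i).
Proof.
elim: m k rows => [|m IH] k rows h i ir /=; first by rewrite addn0; apply: h.
have [sr hr] := next_rows_spec (empty_sum_row_spec l k.+1) h.
by rewrite -addSnnS; apply: IH; rewrite sr.
Qed.

Definition start_rows (l j : nat) : seq (seq N) := nseq j (nseq l N0).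

Lemma start_rows_spec l j i : i < size (start_rows l j) ->
  row_spec l 0 i.+1 (nth [::] (start_rows l j) i).
Proof.
rewrite size_nseq => ij; rewrite nth_nseq ij.
split=> [|n nl]; first by rewrite size_nseq.
by rewrite nth_nseq nl.
Qed.

Lemma p2_all_rows l k j i n : i < j -> n < l <= k.+1 ^ 2 ->
  nat_of_bin (nth N0 (nth [::] (all_rows 0 k (empty_sum_row l) (start_rows l j)) i) n) =
  p2 n i.+1.
Proof.
move=> ij /andP[nl lk].
have [|_ ->] // := @all_rows_spec l 0 k _ (@start_rows_spec l j) i.
  by rewrite size_nseq.
by rewrite add0n (@p2_sq_parts k) // (leq_trans nl).
Qed.

(** * Large and small numbers *)

Definition avoids (m : nat) (r : seq N) : bool :=
  let b := bin_of_nat m in all (fun x => x != b) r.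

(** Below 100^2 only the squares up to 99^2 occur. The rows start at one summand, so index 4 is the
    row for five. *)
Lemma five_squares_table :
  avoids 188
    (nth [::] (all_rows 0 99 (empty_sum_row (100 ^ 2)) (start_rows (100 ^ 2) 5)) 4).
Proof. vm_cast_no_check (erefl true). Qed.

Lemma p2_avoids l k j i m n : i < j -> n < l <= k.+1 ^ 2 ->
  avoids m (nth [::] (all_rows 0 k (empty_sum_row l) (start_rows l j)) i) ->
  p2 n i.+1 <> m.
Proof.
move=> ij nlk /allP av pn; have := p2_all_rows ij nlk.
have [|sr _] := @all_rows_spec l 0 k _ (@start_rows_spec l j) i.
  by rewrite size_nseq.
move: sr av; set r := nth [::] _ i => sr av E.
have /av : nth N0 r n \in r by rewrite mem_nth // sr; case/andP: nlk.
by rewrite -pn -E nat_of_binK eqxx.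
Qed.

Lemma p2_small n : n < 100 ^ 2 -> p2 n 5 <> 188.
Proof.
move=> nl; have nl' : n < 100 ^ 2 <= 99.+1 ^ 2 by rewrite nl leqnn.
exact: p2_avoids (isT : 4 < 5) nl' five_squares_table.
Qed.

Lemma nat_sqrt n : exists r, r ^ 2 <= n < r.+1 ^ 2.
Proof.
elim: n => [|n [r /andP[h1 h2]]]; first by exists 0.
case: (ltnP n.+1 (r.+1 ^ 2)) => h; [exists r | exists r.+1]; apply/andP; split=> //.
  exact: leqW.
by apply: leq_ltn_trans h2 _; rewrite ltn_exp2r.
Qed.

Lemma leq_sigma n : 0 < n -> n <= sigma n.
Proof.
move=> n0; rewrite /sigma (big_rem n) /= ?leq_addr //.
by rewrite -dvdn_divisors.
Qed.

(** The even case decides the constant: 24 sigma(u) with 2u <= n yields 12, while odd [n] would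
    yield 8. *)
Lemma four_squares_upper n r : 0 < n < r.+1 ^ 2 ->
  26 * size (sq_vecs 4 n) <= 12 * (75 + r) * n.
Proof.
case/andP=> n0 nr.
have S u : odd u -> u <= n -> 26 * sigma u <= (75 + r) * u.
  move=> ou un; have [q /andP[q1 q2]] := nat_sqrt u.
  have qr : q <= r.
    have : q ^ 2 < r.+1 ^ 2 by apply: leq_ltn_trans q1 (leq_ltn_trans un nr).
    by rewrite ltn_exp2r.
  apply: (@leq_trans ((75 + q) * u)); first by apply: sigma_bound; rewrite ?q1.
  by rewrite leq_mul2r leq_add2l qr orbT.
have [on|en] := boolP (odd n).
  by rewrite four_squares_odd //; have := S n on (leqnn n); nia.
have [u [ou un su]] := four_squares_even n0 en.
have {}S : 26 * sigma u <= (75 + r) * u by apply: S => //; lia.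
have : 24 * ((75 + r) * u) <= 12 * (75 + r) * n by nia.
lia.
Qed.

(** Fix as first coordinate a or -a, where a is 2i or 2i - 1, of parity opposite to [n]. Then n -
    a^2 is odd, and r_4(n - a^2) = 8 sigma(n - a^2) >= 8(n - a^2); the two signs give 16. *)
Lemma five_squares_lower n k : (2 * k) ^ 2 <= n ->
  16 * \sum_(1 <= i < k.+1) (n - (2 * i) ^ 2) <= size (sq_vecs 5 n).
Proof.
move=> kn; pose a i := 2 * i - ~~ odd n.
pose s := [seq Posz (a i) | i <- index_iota 1 k.+1].
pose t := [seq (- Posz (a i))%R | i <- index_iota 1 k.+1].
have aE i : 0 < i < k.+1 -> [/\ 0 < a i, a i ^ 2 <= (2 * i) ^ 2, (2 * i) ^ 2 <= n
    & odd (a i) = ~~ odd n].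
  move=> ik; have [/andP[h1 h2] h3] : 0 < a i <= 2 * i /\ odd (a i) = ~~ odd n.
    by rewrite /a; case: (odd n) => /=; lia.
  split=> //; first by rewrite leq_exp2r.
  by apply: leq_trans kn; rewrite leq_exp2r //; lia.
have term i : 0 < i < k.+1 -> 8 * (n - (2 * i) ^ 2) <= size (sq_vecs 4 (n - a i ^ 2)).
  move=> /aE[a0 a1 a2 a3].
  have o : odd (n - a i ^ 2).
    by rewrite oddB ?(leq_trans a1) // oddX /= a3; case: (odd n).
  rewrite four_squares_odd // leq_mul2l /=.
  apply: (@leq_trans (n - a i ^ 2)); first exact: leq_sub2l.
  by rewrite leq_sigma //; case: (n - _) o.
rewrite size_sq_vecsS.
apply: (@leq_trans (\sum_(x <- s ++ t) size (sq_vecs 4 (n - `|x| ^ 2)))).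
  rewrite big_cat !big_map /= -big_split /= big_distrr /=.
  rewrite big_nat [X in _ <= X]big_nat; apply: leq_sum => i ik.
  rewrite abszN absz_nat; move: (term i ik).
  by move: (size _) (n - _) => p q; lia.
apply: leq_sum_uniq; last first.
- move=> x xs _; rewrite andbT mem_roots_le; move: xs; rewrite mem_cat.
  by case/orP=> /mapP[i]; rewrite mem_index_iota => /aE[_ h1 h2 _] ->;
    rewrite ?abszN; apply: leq_trans h1 h2.
- exact: roots_le_uniq.
rewrite cat_uniq !map_inj_in_uniq ?iota_uniq ?andbT /=.
- apply/hasPn => x /mapP[i]; rewrite mem_index_iota => /aE[h _ _ _] ->.
  by apply/mapP => -[j _]; lia.
- by move=> i j; rewrite !mem_index_iota /a => ? ?; lia.
- by move=> i j; rewrite !mem_index_iota /a => ? ?; lia.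
Qed.

(** The formula for the sum of the first [k] squares, cleared of denominators and of subtraction. *)
Lemma sum_sub_squares n k : (2 * k) ^ 2 <= n ->
  3 * \sum_(1 <= i < k.+1) (n - (2 * i) ^ 2) + 2 * k * k.+1 * (2 * k).+1 = 3 * k * n.
Proof.
elim: k => [|k IH] kn; first by rewrite big_geq.
have kn' : (2 * k) ^ 2 <= n by apply: leq_trans kn; rewrite leq_exp2r //; lia.
rewrite big_nat_recr //=; have := IH kn'; nia.
Qed.

(** This contradicts the bounds on r_5 multiplied by 78 = 3 * 26. There 16 * 26 * 3 S, with S the
    sum above, is 1248kn - 832k(k + 1)(2k + 1), and 78 * 5 r_4(n) is at most 15 * 12(76 + 2k)n =
    13680n + 360kn; finally 888 = 1248 - 360. *)
Lemma cubic_gap (n k : nat) : 50 <= k -> (2 * k) ^ 2 <= n ->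
  832 * k * k.+1 * (2 * k).+1 + 1368 * 10 * n + 78 * (32 * 120 * 188) < n * (888 * k).
Proof.
(* In j = k - 50 and m = n - 4k^2 the difference of the sides has only positive coefficients, so
   nonnegativity of the monomials suffices. *)
move=> k50 kn; have [j jE] : exists j, k = 50 + j by exists (k - 50); lia.
have [m mE] : exists m, n = 4 * k * k + m by exists (n - 4 * k * k); nia.
have [h3 h2 hm] : [/\ 0 <= j * j * j, 0 <= j * j & 0 <= j * m] by [].
rewrite mE jE {k50 kn mE jE}.
lia.
Qed.

Theorem theorem6p1 : ~ (exists n : nat, 0 < n /\ p2 n 5 = 188).
Proof.
move=> [n [n0 pn]].
have n1 : 100 ^ 2 <= n by rewrite leqNgt; apply/negP => /p2_small.
have [r /andP[r1 r2]] := nat_sqrt n.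
pose k := r./2.
have kn : (2 * k) ^ 2 <= n by apply: leq_trans r1; rewrite leq_exp2r // /k; lia.
have k50 : 50 <= k.
  have : 100 ^ 2 < r.+1 ^ 2 by apply: leq_ltn_trans n1 r2.
  by rewrite ltn_exp2r // /k; lia.
have rk : r <= 2 * k + 1 by rewrite /k; lia.
have low := five_squares_lower kn.
have sumE := sum_sub_squares kn.
have up : 26 * size (sq_vecs 4 n) <= 12 * (75 + r) * n.
  by apply: four_squares_upper; rewrite n0.
have split5 := sq_vecs_split 4 n; rewrite pn in split5.
(* By r <= 2k + 1 only [n] and [k] remain in the bound. *)
have {r1 r2}up : 26 * size (sq_vecs 4 n) <= 12 * (76 + 2 * k) * n.
  by apply: leq_trans up _; rewrite leq_mul2r leq_mul2l; lia.
rewrite (_ : 2 ^ 5 * 5`! = 32 * 120) // in split5.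
have := cubic_gap k50 kn; rewrite ltnNge => /negP[].
move: sumE low split5 up; set S := \sum_(_ <= _ < _) _; lia.
Qed.
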